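(* Assume the setting of the context (random weights). Fix $T_1>0$ and suppose Assumptions (A1R), (A2R) and (A3R) hold. Then for every $\varepsilon>0$, \[\lim_{n\rightarrow\infty}\mathbb{P}_{\mu}\left(\sup_{x\in F}\sup_{t\geq T_1}\left|\beta(n)q^n_{\lfloor\gamma(n)t\rfloor}(g_n(x))-q_t(x)\right|>\varepsilon\right)=0.\]
   Context: Let $(E,d_E)$ be a metric space and $F\subseteq E$ such that $F\cap\overline{B}_E(x,r)$ is compact for all $x\in E$, $r>0$ ($\overline{B}_E$, $B_E$ closed and open balls in $E$). Let $d_F:=d_E|_{F\times F}$, $B_F(x,r)$ the open ball in $(F,d_F)$, $\rho\in F$, $\nu$ a Radon measure of full support on $(F,d_F)$ (extended to $E$ by $\nu(A):=\nu(A\cap F)$), and $(q_t(x))_{x\in F,t>0}$ jointly continuous in $(t,x)$ with $q_t\ge0$, $\int_Fq_t\,d\nu=1$ for each $t>0$. For a locally finite connected graph $G$ with at least two vertices and distinguished vertex $\rho(G)$: $d_G$ is the shortest-path metric, $B_G(x,r)$ the open $d_G$-ball; $\mu^G$ a symmetric weight with $\mu^G_{xy}>0$ iff $\{x,y\}$ is an edge; $\mu^G_x:=\sum_y\mu^G_{xy}$; $\nu^G(A):=\sum_{x\in A}\mu^G_x$; $X^G$ the discrete time simple random walk with $P_G(x,y)=\mu^G_{xy}/\mu^G_x$, law $\mathbf{P}^G_x$; $p^G_m(x,y):=\mathbf{P}^G_x(X^G_m=y)/\nu^G(\{y\})$, $q^G_m(x,y):=\frac12(p^G_m+p^G_{m+1})(x,y)$,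 $q^G_m(x):=q^G_m(\rho(G),x)$. $(G^n)_{n\ge1}$ are such graphs with $V(G^n)\subseteq E$, $\rho(G^n)=\rho$; write $\nu^n,X^n,q^n$ for $\nu^{G^n},X^{G^n},q^{G^n}$. The weights of all the $G^n$ are random, given by a random element of $(0,\infty)^{\cup_nE(G^n)}$ with law $\mathbb{P}_\mu$. $(\alpha(n)),(\beta(n)),(\gamma(n))$ are non-negative deterministic sequences diverging to $\infty$. For $x\in E$, $g_n(x)$ is a point of $V(G^n)$ minimising $d_E(x,\cdot)$. Assumption (A1R): (a) there is $c_1>0$ with $d_{G^n}(x,y)\ge c_1\alpha(n)d_E(x,y)$ for all $x,y\in V(G^n)$, $n\ge1$, and a non-negative $\tilde\alpha(n)=o(\alpha(n))$ such that for each $r>0$ there are $c_2<\infty$, $n_0$ with $d_{G^n}(x,y)\le c_2\alpha(n)d_E(x,y)+\tilde\alpha(n)$ for all $x,y\in V(G^n)\cap B_E(\rho,r)$, $n\ge n_0$; (b) for each $r>0$, $\lim_n\sup_{x\in B_F(\rho,r)}d_E(x,V(G^n))=0$; (c) for every $x\in F$, $r,\varepsilon>0$, $\lim_n\mathbb{P}_\mu(|\beta(n)^{-1}\nu^n(B_E(x,r))-\nu(B_E(x,r))|>\varepsilon)=0$; (d) for every compact interval $I\subset(0,\infty)$, $x\in F$, $r,\varepsilon>0$, $\lim_n\mathbb{P}_\mu(\sup_{t\in I}|\mathbf{P}^{G^n}_\rho(X^n_{\lfloor\gamma(n)t\rfloor}\in B_E(x,r))-\int_{B_E(x,r)}q_t(y)\nu(dy)|>\varepsilon)=0$.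 Assumption (A2R): for every compact interval $I\subset(0,\infty)$ and $r,\varepsilon>0$, \[\lim_{\delta\to0}\limsup_{n\to\infty}\mathbb{P}_\mu\Big(\sup_{\substack{x,y\in B_{G^n}(\rho,\alpha(n)r):\\ d_{G^n}(x,y)\le\alpha(n)\delta}}\sup_{t\in I}\beta(n)\big|q^n_{\lfloor\gamma(n)t\rfloor}(x)-q^n_{\lfloor\gamma(n)t\rfloor}(y)\big|>\varepsilon\Big)=0.\] Assumption (A3R): $(F,d_F)$ has the midpoint property (for all $x,y\in F$ there is $z\in F$ with $d_F(x,z)=\frac12d_F(x,y)=d_F(z,y)$); (a) $\lim_{t\to\infty}\sup_{x\in F}q_t(x)=0$ and $\lim_{r\to\infty}\sup_{x\in F\setminus B_F(\rho,r)}\sup_{t\in I}q_t(x)=0$ for every compact interval $I\subset(0,\infty)$; (b) for every $\varepsilon>0$, $\lim_{t\to\infty}\limsup_n\mathbb{P}_\mu(\sup_{x\in V(G^n)}\beta(n)q^n_{\lfloor\gamma(n)t\rfloor}(x)>\varepsilon)=0$, and for every compact interval $I\subset(0,\infty)$ and $\varepsilon>0$, $\lim_{r\to\infty}\limsup_n\mathbb{P}_\mu(\sup_{x\in V(G^n)\setminus B_{G^n}(\rho,\alpha(n)r)}\sup_{t\in I}\beta(n)q^n_{\lfloor\gamma(n)t\rfloor}(x)>\varepsilon)=0$. *)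

(* Defs.v *)
From HB Require Import structures.
From mathcomp Require Import all_boot all_order all_algebra.
From mathcomp Require Import all_classical all_reals all_analysis.
Set Implicit Arguments. Unset Strict Implicit. Unset Printing Implicit Defensive.
Import Order.TTheory GRing.Theory Num.Theory.
Local Open Scope classical_set_scope.
Local Open Scope ring_scope.

Section Metric.
Context {R : realType} {E : Type} (d : E -> E -> R).

Definition is_metric : Prop :=
  [/\ forall x y, 0 <= d x y,
      forall x y, d x y = 0 <-> x = y,
      forall x y, d x y = d y x &
      forall x y z, d x z <= d x y + d y z].

Definition dball (x : E) (r : R) : set E := [set y | d x y < r].
Definition dcball (x : E) (r : R) : set E := [set y | d x y <= r].

Definition dopen (U : set E) : Prop :=
  forall x, U x -> exists2 r, 0 < r & dball x r `<=` U.

Definition dcompact (K : set E) : Prop :=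
  forall C : set (set E), (forall U, C U -> dopen U) ->
    K `<=` \bigcup_(U in C) U ->
    exists s : seq (set E), (forall U, U \in s -> C U) /\
      K `<=` \bigcup_(U in [set U | U \in s]) U.

Definition midpoint_property (F : set E) : Prop :=
  forall x y, F x -> F y -> exists2 z, F z &
    d x z = d x y / 2 /\ d z y = d x y / 2.
End Metric.

Section Graphs.
Context {E : Type}.

Fixpoint reach (adj : E -> E -> Prop) (k : nat) (x y : E) : Prop :=
  match k with
  | 0%N => x = y
  | k'.+1 => exists z, adj x z /\ reach adj k' z y
  end.

Definition lf_conn_graph (V : set E) (adj : E -> E -> Prop) (rho : E) : Prop :=
  V rho /\
  (exists x y, [/\ V x, V y & x <> y]) /\
  (forall x y, adj x y -> V x /\ V y) /\
  (forall x y, adj x y -> adj y x) /\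
  (forall x, ~ adj x x) /\
  (forall x, finite_set [set y | adj x y]) /\
  (forall x y, V x -> V y -> exists k, reach adj k x y).

Definition gdist {R : realType} (adj : E -> E -> Prop) (x y : E) : R :=
  inf [set (k%:R : R) | k in [set k | reach adj k x y]].
End Graphs.

Section Walk.
Context {R : realType} {E : choiceType} (adj : E -> E -> Prop) (mu : E -> E -> R).

Definition wdeg (x : E) : R := \sum_(y \in [set y | adj x y]) mu x y.
Definition trans (x y : E) : R := mu x y / wdeg x.
(* hitp m B x = P_x(X_m \in B) *)
Fixpoint hitp (m : nat) (B : set E) (x : E) : R :=
  match m with
  | 0%N => \1_B x
  | m'.+1 => \sum_(z \in [set z | adj x z]) trans x z * hitp m' B z
  end.
Definition gmeas (V : set E) (A : set E) : \bar R :=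
  \esum_(x in A `&` V) (wdeg x)%:E.
(* p^G_m(x,y) = P_x(X_m = y) / nu^G({y}) *)
Definition pker (m : nat) (x y : E) : R := hitp m [set y] x / wdeg y.
Definition qker (m : nat) (x y : E) : R := (pker m x y + pker m.+1 x y) / 2.
End Walk.

(* outer probability; it coincides with P on measurable events *)
Definition outerP {d} {Omega : measurableType d} {R : realType}
  (P : probability Omega R) (A : set Omega) : \bar R :=
  ereal_inf [set P B | B in [set B | measurable B /\ A `<=` B]].

Definition nfloor {R : realType} (s : R) : nat := Num.truncn s.

(* nu is a measure on (F, d_F), extended to E by nu(A) := nu(A \cap F) *)
Definition extended_from {d} {E : measurableType d} {R : realType}
  (F : set E) (nu : {measure set E -> \bar R}) : Prop :=
  forall A, measurable A -> nu A = nu (A `&` F).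

Definition radon_on {d} {E : measurableType d} {R : realType}
  (dist : E -> E -> R) (F : set E) (nu : {measure set E -> \bar R}) : Prop :=
  (forall x, F x -> exists2 r, 0 < r & (nu (dball dist x r `&` F) < +oo)%E) /\
  (forall A, measurable A ->
     nu (A `&` F) =
     ereal_sup [set nu K | K in [set K | dcompact dist K /\ K `<=` A `&` F]]).

Definition full_support_on {d} {E : measurableType d} {R : realType}
  (dist : E -> E -> R) (F : set E) (nu : {measure set E -> \bar R}) : Prop :=
  forall x r, F x -> 0 < r -> (0 < nu (dball dist x r `&` F))%E.

Definition limit_kernel {d} {E : measurableType d} {R : realType}
  (dist : E -> E -> R) (F : set E) (nu : {measure set E -> \bar R})
  (q : R -> E -> R) : Prop :=
  (forall t x, 0 < t -> F x ->
     forall eps, 0 < eps -> exists2 eta, 0 < eta &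
       forall s y, 0 < s -> F y -> `|s - t| < eta -> dist x y < eta ->
         `|q s y - q t x| < eps) /\
  (forall t x, 0 < t -> F x -> 0 <= q t x) /\
  (forall t, 0 < t -> (\int[nu]_(x in F) (q t x)%:E = 1)%E).

Definition random_weights {dO} {Omega : measurableType dO} {E : Type}
  {R : realType} (adj : nat -> E -> E -> Prop)
  (w : Omega -> nat -> E -> E -> R) : Prop :=
  (forall om n x y, w om n x y = w om n y x) /\
  (forall om n x y, adj n x y -> 0 < w om n x y) /\
  (forall om n x y, ~ adj n x y -> w om n x y = 0) /\
  (forall n x y, measurable_fun setT (fun om => w om n x y)).

Definition qn {Omega : Type} {E : choiceType} {R : realType}
  (adj : nat -> E -> E -> Prop) (w : Omega -> nat -> E -> E -> R)
  (rho : E) (n : nat) (om : Omega) (m : nat) (x : E) : R :=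
  qker (adj n) (w om n) m rho x.

Definition A1R {d} {E : measurableType d} {dO} {Omega : measurableType dO}
  {R : realType} (dist : E -> E -> R) (F : set E) (rho : E)
  (nu : {measure set E -> \bar R}) (q : R -> E -> R)
  (V : nat -> set E) (adj : nat -> E -> E -> Prop)
  (P : probability Omega R) (w : Omega -> nat -> E -> E -> R)
  (alpha beta gamma : nat -> R) : Prop :=
  (exists2 c1 : R, 0 < c1 & forall n x y, V n x -> V n y ->
      c1 * alpha n * dist x y <= gdist (adj n) x y) /\
  (exists alt : nat -> R,
      (forall n, 0 <= alt n) /\
      (forall eta : R, 0 < eta -> \forall n \near \oo, alt n <= eta * alpha n) /\
      (forall r : R, 0 < r -> exists c2 : R, exists n0 : nat,
         forall n, (n0 <= n)%N -> forall x y, V n x -> V n y ->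
           dist rho x < r -> dist rho y < r ->
           gdist (adj n) x y <= c2 * alpha n * dist x y + alt n)) /\
  (forall r : R, 0 < r -> forall eta : R, 0 < eta ->
     \forall n \near \oo, forall x, F x -> dist rho x < r ->
        exists2 v, V n v & dist x v < eta) /\
  (forall x (r eps : R), F x -> 0 < r -> 0 < eps ->
     outerP P [set om | (eps%:E <
        `| (beta n)^-1%:E * gmeas (adj n) (w om n) (V n) (dball dist x r)
           - nu (dball dist x r `&` F) |)%E]
     @[n --> \oo] --> 0%E) /\
  (forall (a b : R) x (r eps : R), 0 < a -> a <= b -> F x -> 0 < r -> 0 < eps ->
     outerP P [set om | exists t, a <= t <= b /\
        (eps%:E < `| (hitp (adj n) (w om n) (nfloor (gamma n * t))
                          (dball dist x r) rho)%:E
                     - \int[nu]_(y in dball dist x r `&` F) (q t y)%:E |)%E]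
     @[n --> \oo] --> 0%E).

Definition A2R {E : choiceType} {dO} {Omega : measurableType dO}
  {R : realType} (rho : E)
  (V : nat -> set E) (adj : nat -> E -> E -> Prop)
  (P : probability Omega R) (w : Omega -> nat -> E -> E -> R)
  (alpha beta gamma : nat -> R) : Prop :=
  forall (a b r eps : R), 0 < a -> a <= b -> 0 < r -> 0 < eps ->
    (fun delta : R => limn_esup (fun n =>
       outerP P [set om | exists x y t,
          [/\ V n x, V n y, gdist (adj n) rho x < alpha n * r,
              gdist (adj n) rho y < alpha n * r &
              gdist (adj n) x y <= alpha n * delta] /\
          a <= t <= b /\
          eps < beta n * `| qn adj w rho n om (nfloor (gamma n * t)) x
                            - qn adj w rho n om (nfloor (gamma n * t)) y |]))
    @ 0^'+ --> 0%E.

Definition A3R {d} {E : measurableType d} {dO} {Omega : measurableType dO}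
  {R : realType} (dist : E -> E -> R) (F : set E) (rho : E)
  (q : R -> E -> R)
  (V : nat -> set E) (adj : nat -> E -> E -> Prop)
  (P : probability Omega R) (w : Omega -> nat -> E -> E -> R)
  (alpha beta gamma : nat -> R) : Prop :=
  midpoint_property dist F /\
  (forall eta : R, 0 < eta -> exists T : R,
     forall t x, T <= t -> F x -> q t x <= eta) /\
  (forall (a b : R), 0 < a -> a <= b -> forall eta : R, 0 < eta ->
     exists r0 : R, forall r x t, r0 <= r -> F x -> ~ (dist rho x < r) ->
       a <= t <= b -> q t x <= eta) /\
  (forall eps : R, 0 < eps ->
    (fun t : R => limn_esup (fun n =>
       outerP P [set om | exists x, V n x /\
          eps < beta n * qn adj w rho n om (nfloor (gamma n * t)) x]))
    @ +oo --> 0%E) /\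
  (forall (a b eps : R), 0 < a -> a <= b -> 0 < eps ->
    (fun r : R => limn_esup (fun n =>
       outerP P [set om | exists x t, V n x /\
          ~ (gdist (adj n) rho x < alpha n * r) /\ a <= t <= b /\
          eps < beta n * qn adj w rho n om (nfloor (gamma n * t)) x]))
    @ +oo --> 0%E).

(* Main.v *)
Require Import Defs.
From HB Require Import structures.
From mathcomp Require Import all_boot all_order all_algebra.
From mathcomp Require Import all_classical all_reals all_analysis.
From mathcomp Require Import measurable_realfun lra.
Import Order.TTheory GRing.Theory Num.Theory.
Local Open Scope classical_set_scope.
Local Open Scope ring_scope.

(* For t past a large T, both kernels are uniformly small by (A3R); a single
   time suffices on the graph side because, by reversibility, the supremum of
   q^n_m is nonincreasing in m. For t in [T1, T] and x far from rho both kernels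
   are again small; here the midpoint property provides a point z between rho and
   x, and since V(G^n) is dense near z the nearest vertex g_n(x) is far from rho
   too. On the remaining compact set of times and points, compare averages over a
   small ball B around x: A1R(c) and A1R(d) control nu^n(B) and P_rho(X_m in B),
   while A2R (for q^n) and joint continuity (for q) make the averages close to the
   values at the centre. Finitely many such balls suffice. All events are handled
   through outer probability, so no measurability of suprema is needed. *)

(** * Sums over finite sets *)

Section FiniteSums.
Context {R : realDomainType} {I : choiceType}.
Implicit Types (A : set I) (f g : I -> R).

Lemma ler_fsum {A f g} : finite_set A -> (forall i, A i -> f i <= g i) ->
  \sum_(i \in A) f i <= \sum_(i \in A) g i.
Proof.
move=> finA fg; rewrite !fsbig_finite//= big_seq [leRHS]big_seq.
by apply: ler_sum => i; rewrite in_fset_set// inE => /fg.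
Qed.

Lemma ler_norm_fsum {A f} : finite_set A ->
  `|\sum_(i \in A) f i| <= \sum_(i \in A) `|f i|.
Proof. by move=> finA; rewrite !fsbig_finite//=; exact: ler_norm_sum. Qed.

Lemma fsumr1_gt0 {A f} a : finite_set A -> (forall i, A i -> 0 <= f i) ->
  A a -> 0 < f a -> 0 < \sum_(i \in A) f i.
Proof.
move=> finA f0 Aa fa; rewrite (fsbigD1 a)//=; apply: ltr_wpDr => //.
by apply: fsumr_ge0 => i [/f0].
Qed.

Lemma fsum_indicator {A} f a : finite_set A ->
  \sum_(i \in A) f i * \1_[set a] i = \1_A a * f a.
Proof.
move=> finA; have [Aa|nAa] := pselect (A a).
  rewrite (fsbigD1 a)//= !indicE !mem_set// mulr1 mul1r fsbig1 ?addr0// => i [_ ia].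
  by rewrite indicE memNset// mulr0.
rewrite fsbig1 ?[\1_A a]indicE ?memNset ?mul0r// => i Ai.
by rewrite indicE memNset ?mulr0//= => ia; apply: nAa; rewrite -ia.
Qed.
End FiniteSums.

(** * Reversible random walk on a weighted graph *)

Section WeightedGraph.
Context {R : realType} {E : choiceType} {V : set E} {adj : E -> E -> Prop}
  {rho : E} {mu : E -> E -> R}.
Hypothesis graph : lf_conn_graph V adj rho.
Hypothesis mu_sym : forall x y, mu x y = mu y x.
Hypothesis mu_gt0 : forall x y, adj x y -> 0 < mu x y.

Let nbrs_fin x : finite_set [set y | adj x y].
Proof. by case: graph => _ [_ [_ [_ [_ [+ _]]]]]; apply. Qed.

Let adj_sym {x y} : adj x y -> adj y x.
Proof. by case: graph => _ [_ [_ [+ _]]]; apply. Qed.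

Let adjV {x y} : adj x y -> V x /\ V y.
Proof. by case: graph => _ [_ [+ _]]; apply. Qed.

Lemma reach_finite k x : finite_set [set y | reach adj k x y].
Proof.
elim: k x => [|k IH] x /=.
  by rewrite (_ : mkset _ = [set x])//; apply/seteqP; split => y /=.
rewrite (_ : mkset _ = \bigcup_(z in [set z | adj x z]) [set y | reach adj k z y]).
  by apply: bigcup_finite.
by apply/seteqP; split => y /= [z]; [move=> []; exists z|exists z].
Qed.

Lemma gdist_has_inf {x y} : V x -> V y ->
  has_inf [set (k%:R : R) | k in [set k | reach adj k x y]].
Proof.
case: graph => _ [_ [_ [_ [_ [_ conn]]]]] Vx Vy; split; last first.
  by exists 0 => _ [k _ <-].
by have [k xy] := conn x y Vx Vy; exists k%:R, k.
Qed.

(** Distances are infima of path lengths, so a vertex at distance below [l] ends a path of fewer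
    than [N] steps, and local finiteness leaves finitely many such ends. This turns ball masses into
    finite sums. *)
Lemma gdist_ball_finite (x : E) (l : R) : V x ->
  finite_set [set y | V y /\ gdist adj x y < l].
Proof.
move=> Vx; pose N := (Num.truncn l).+1.
apply: (@sub_finite_set _ _ (\bigcup_(k in `I_N) [set y | reach adj k x y])); last first.
  by apply: bigcup_finite => [|k _]; [exact: finite_II|exact: reach_finite].
move=> y [Vy dl]; have l0 : 0 < l - gdist adj x y by rewrite subr_gt0.
have [_ [k xy <-]] := inf_adherent l0 (gdist_has_inf Vx Vy).
rewrite -/(gdist adj x y) => kl; exists k => //=.
have : k%:R < N%:R :> R by have := truncnS_gt l; rewrite /N; lra.
by rewrite ltr_nat.
Qed.

(** Two distinct vertices and connectedness give every vertex a neighbour, whose edge weight is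
    positive. *)
Lemma wdeg_gt0 {x} : V x -> 0 < wdeg adj mu x.
Proof.
move=> Vx; case: graph => _ [[a [b [Va Vb ab]]] [_ [_ [_ [_ conn]]]]].
have [y xy] : exists y, adj x y.
  have [c Vc xc] : exists2 c, V c & x <> c.
    by have [xa|] := pselect (x = a); [exists b => //; rewrite xa|exists a].
  by have [[|k] /=] := conn x c Vx Vc; [move/xc|case=> z [? _]; exists z].
by apply: (fsumr1_gt0 y) => //= [i /mu_gt0/ltW//|]; exact: mu_gt0.
Qed.

Lemma trans_sum {x} : V x -> \sum_(z \in [set z | adj x z]) trans adj mu x z = 1.
Proof.
by move=> Vx; rewrite -mulr_fsuml mulfV// gt_eqF// wdeg_gt0.
Qed.

Lemma trans_ge0 {x z} : adj x z -> 0 <= trans adj mu x z.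
Proof.
by move=> xz; rewrite divr_ge0 ?ltW ?mu_gt0// wdeg_gt0//; have [] := adjV xz.
Qed.

Lemma hitp_ge0 m B x : 0 <= hitp adj mu m B x.
Proof.
elim: m x => [|m IH] x /=; first by rewrite indicE.
by apply: fsumr_ge0 => z /= xz; rewrite mulr_ge0 ?trans_ge0.
Qed.

Lemma hitpS m B x : hitp adj mu m.+1 B x =
  \sum_(z \in [set z | adj x z]) trans adj mu x z * hitp adj mu m B z.
Proof. by []. Qed.

(** [hitp] unfolds the first step of the walk; the decomposition at the last step is the one to
    which reversibility applies. *)
Lemma hitp_forward m x y : hitp adj mu m.+1 [set y] x =
  \sum_(z \in [set z | adj y z]) hitp adj mu m [set z] x * trans adj mu z y.
Proof.
elim: m x => [|m IH] x.
  rewrite /= fsum_indicator//.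
  under eq_fsbigr.
    move=> z _; rewrite mulrC (_ : \1_[set z] x = \1_[set x] z); last first.
      by rewrite !indicE; congr (_%:R); congr nat_of_bool; apply/idP/idP; rewrite !inE /= => ->.
    over.
  rewrite fsum_indicator//; congr (_ * _); rewrite !indicE; congr (_%:R); congr nat_of_bool.
  by apply/idP/idP; rewrite !inE /=; exact: adj_sym.
rewrite hitpS; under eq_fsbigr do rewrite IH mulr_fsumr.
rewrite exchange_fsbig//; apply: eq_fsbigr => z _ /=.
by rewrite mulr_fsuml; apply: eq_fsbigr => u _; rewrite mulrA.
Qed.

(** Detailed balance: by symmetry of [mu], [trans z y / wdeg y] equals [trans y z / wdeg z], so the
    last step into [y] becomes a step out of [y]. *)
Lemma pker_forward m x {y} : V y -> pker adj mu m.+1 x y =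
  \sum_(z \in [set z | adj y z]) trans adj mu y z * pker adj mu m x z.
Proof.
move=> Vy; rewrite /pker hitp_forward mulr_fsuml; apply: eq_fsbigr => z.
rewrite inE /= => yz; rewrite /trans mu_sym.
by rewrite [in RHS]mulrAC [in RHS]mulrCA -!mulrA; congr (_ * _); rewrite mulrCA mulrC mulrA.
Qed.

Lemma qker_ge0 m x y : V y -> 0 <= qker adj mu m x y.
Proof.
move=> Vy; rewrite divr_ge0// addr_ge0// divr_ge0 ?hitp_ge0 ?ltW//; exact: wdeg_gt0.
Qed.

(* By reversibility [q_(m+1)(x, .)] is an average of [q_m(x, .)]. *)
Lemma qker_ub_nincr (x : E) (c : R) m n : (m <= n)%N ->
  (forall y, V y -> qker adj mu m x y <= c) ->
  forall y, V y -> qker adj mu n x y <= c.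
Proof.
move=> /subnK <-; elim: (n - m)%N => [|k IH] mc y Vy; first exact: mc.
have -> : qker adj mu (k.+1 + m) x y =
    \sum_(z \in [set z | adj y z]) trans adj mu y z * qker adj mu (k + m) x z.
  rewrite /qker addSn !pker_forward// -fsbig_split//= mulr_fsuml.
  by apply: eq_fsbigr => z _; rewrite -mulrDr mulrA.
rewrite -[leRHS]mul1r -(trans_sum Vy) mulr_fsuml.
apply: ler_fsum => //= z yz; rewrite ler_wpM2l ?trans_ge0//.
by apply: IH => //; have [] := adjV yz.
Qed.

Lemma hitp_sum m B x : finite_set B ->
  hitp adj mu m B x = \sum_(y \in B) hitp adj mu m [set y] x.
Proof.
move=> finB; elim: m x => [|m IH] x /=.
  transitivity (\sum_(y \in B) (1 : R) * \1_[set x] y).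
    by rewrite fsum_indicator// mulr1.
  apply: eq_fsbigr => y _; rewrite mul1r !indicE; congr (_%:R); congr nat_of_bool.
  by apply/idP/idP; rewrite !inE /= => ->.
under eq_fsbigr do rewrite IH mulr_fsumr.
by rewrite exchange_fsbig.
Qed.

Lemma hitp_setIV m B x : V x -> hitp adj mu m B x = hitp adj mu m (B `&` V) x.
Proof.
elim: m x => [|m IH] x Vx /=.
  rewrite !indicE; congr (_%:R); congr nat_of_bool.
  by apply/idP/idP; rewrite !inE /=; [|case].
by apply: eq_fsbigr => z; rewrite inE /= => xz; rewrite IH//; have [] := adjV xz.
Qed.

Lemma hitp_qker m B x : V x -> finite_set (B `&` V) ->
  (hitp adj mu m B x + hitp adj mu m.+1 B x) / 2 =
  \sum_(y \in B `&` V) qker adj mu m x y * wdeg adj mu y.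
Proof.
move=> Vx finB; rewrite !(hitp_setIV _ B)// !(hitp_sum _ (B `&` V))//.
rewrite -fsbig_split//= mulr_fsuml; apply: eq_fsbigr => y; rewrite inE => -[_ Vy].
have := wdeg_gt0 Vy; rewrite /qker /pker => /gt_eqF/negbT d0.
by rewrite -mulrDl [in RHS]mulrAC divfK.
Qed.

(** By [hitp_qker] the averaged hitting probability is the integral of [qker] over [B], so a bound
    on the oscillation allows its value at [v] to be taken out. *)
Lemma hitp_qker_close m B x v (b e : R) :
  V x -> finite_set (B `&` V) -> 0 <= b ->
  (forall y, (B `&` V) y -> b * `|qker adj mu m x y - qker adj mu m x v| <= e) ->
  `|b * ((hitp adj mu m B x + hitp adj mu m.+1 B x) / 2)
    - b * qker adj mu m x v * \sum_(y \in B `&` V) wdeg adj mu y|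
  <= e * \sum_(y \in B `&` V) wdeg adj mu y.
Proof.
move=> Vx finB b0 osc; rewrite hitp_qker// !mulr_fsumr.
have -> : forall f g : E -> R, \sum_(y \in B `&` V) f y - \sum_(y \in B `&` V) g y =
    \sum_(y \in B `&` V) (f y - g y).
  by move=> f g; rewrite !fsbig_finite//= sumrB.
apply: le_trans (ler_norm_fsum finB) _; apply: ler_fsum => // y By.
rewrite mulrA -mulrBl -mulrBr !normrM (ger0_norm b0).
have wy : 0 <= wdeg adj mu y by apply/ltW/wdeg_gt0; case: By.
by rewrite (ger0_norm wy) ler_wpM2r// osc.
Qed.

Lemma gmeas_finite B : finite_set (B `&` V) ->
  gmeas adj mu V B = (\sum_(y \in B `&` V) wdeg adj mu y)%:E.
Proof.
move=> finB; rewrite /gmeas esum_fset// => [|y]; first by rewrite fsumEFin.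
by rewrite inE lee_fin => -[_ /wdeg_gt0/ltW].
Qed.
End WeightedGraph.

(** * Outer probability and convergence to zero *)

Section OuterProbability.
Context {dO : measure_display} {Omega : measurableType dO} {R : realType}
  {P : probability Omega R}.
Implicit Types A B : set Omega.

Lemma outerP_ge0 A : (0 <= outerP P A)%E.
Proof. by apply: le_ereal_inf_tmp => _ [B _ <-]. Qed.

Lemma le_outerP {A B} : A `<=` B -> (outerP P A <= outerP P B)%E.
Proof.
move=> AB; apply: ereal_inf_le_tmp => _ [C [mC BC] <-].
by exists C => //; split=> //; exact: subset_trans BC.
Qed.

Lemma outerP_le1 A : (outerP P A <= 1)%E.
Proof. by apply: ereal_inf_lbound; exists setT; [split|exact: probability_setT]. Qed.

(** A strict bound on an infimum provides a measurable cover below it; the two covers together cover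
    the union. *)
Lemma outerPU_le {A B} {a b : R} : (outerP P A < a%:E)%E -> (outerP P B < b%:E)%E ->
  (outerP P (A `|` B) < (a + b)%:E)%E.
Proof.
move=> /ereal_inf_lt[_ [C [mC AC] <-] Ca] /ereal_inf_lt[_ [D [mD BD] <-] Db].
apply: (@le_lt_trans _ _ (P (C `|` D))); last first.
  by rewrite EFinD; apply: le_lt_trans (measureU2 _ mC mD) _; exact: lteD.
apply: ereal_inf_lbound; exists (C `|` D) => //.
by split; [exact: measurableU|exact: setUSS].
Qed.

(** Outer probabilities lie between 0 and 1, so they are finite and only an upper bound is at
    stake. *)
Lemma outerP0_near (A : nat -> set Omega) :
  (outerP P (A n) @[n --> \oo] --> 0%E) <->
  (forall eta : R, 0 < eta -> \forall n \near \oo, (outerP P (A n) < eta%:E)%E).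
Proof.
split=> [/fine_cvgP[fin /cvgrPdist_lt cv] eta eta0|small].
  near=> n; have fn : outerP P (A n) \is a fin_num by near: n.
  rewrite -(fineK fn) lte_fin; apply: le_lt_trans (ler_norm _) _.
  by rewrite -[X in `|X|]opprK normrN -sub0r; near: n; exact: cv.
have fn n : outerP P (A n) \is a fin_num.
  by rewrite fin_numElt (lt_le_trans _ (outerP_ge0 _))//= (le_lt_trans (outerP_le1 _))// ltry.
apply/fine_cvgP; split; first exact: nearW.
apply/cvgrPdist_lt => eta eta0; near=> n.
rewrite sub0r normrN ger0_norm; last by rewrite fine_ge0// outerP_ge0.
by rewrite -lte_fin fineK//; near: n; exact: small.
Unshelve. all: by end_near. Qed.

Lemma outerP0_sub {A B : nat -> set Omega} : (\forall n \near \oo, A n `<=` B n) ->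
  outerP P (B n) @[n --> \oo] --> 0%E -> outerP P (A n) @[n --> \oo] --> 0%E.
Proof.
move=> AB /outerP0_near B0; apply/outerP0_near => eta /B0 Beta.
near=> n; apply: (@le_lt_trans _ _ (outerP P (B n))); last by near: n.
by apply: le_outerP; near: n.
Unshelve. all: by end_near. Qed.

Lemma outerP0_setU {A B : nat -> set Omega} :
  outerP P (A n) @[n --> \oo] --> 0%E -> outerP P (B n) @[n --> \oo] --> 0%E ->
  outerP P (A n `|` B n) @[n --> \oo] --> 0%E.
Proof.
move=> /outerP0_near A0 /outerP0_near B0; apply/outerP0_near => eta eta0.
have eta20 : 0 < eta / 2 by rewrite divr_gt0.
near=> n; rewrite (splitr eta); apply: outerPU_le; near: n; [exact: A0|exact: B0].
Unshelve. all: by end_near. Qed.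

Lemma outerP0_set0 : outerP P ((fun=> set0) n) @[n --> \oo] --> 0%E.
Proof.
apply/outerP0_near => eta eta0; apply: nearW => n; apply: (@le_lt_trans _ _ 0%E) => //.
by apply: ereal_inf_lbound; exists set0; [split|rewrite measure0].
Qed.

Lemma outerP0_bigU {I : choiceType} (s : seq I) (A : I -> nat -> set Omega) :
  (forall i, i \in s -> outerP P (A i n) @[n --> \oo] --> 0%E) ->
  outerP P (\bigcup_(i in [set i | i \in s]) A i n) @[n --> \oo] --> 0%E.
Proof.
elim: s => [|j s IH] As.
  by apply: outerP0_sub outerP0_set0; apply: nearW => n om [].
apply: (@outerP0_sub _ (fun n => A j n `|` \bigcup_(i in [set i | i \in s]) A i n)).
  apply: nearW => n om [i /=]; rewrite inE => /orP[/eqP ->|si] Ai; first by left.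
  by right; exists i.
apply: outerP0_setU; first by apply: As; rewrite inE eqxx.
by apply: IH => i si; apply: As; rewrite inE si orbT.
Qed.

Lemma limn_esup_near {u : nat -> \bar R} {c : \bar R} :
  (limn_esup u < c)%E -> \forall n \near \oo, (u n < c)%E.
Proof.
move=> /ereal_inf_lt[_ [B nB <-] Bc]; apply: filterS nB => n Bn.
by apply: le_lt_trans Bc; apply: ereal_sup_ubound; exists n.
Qed.

(** The form in which the iterated limits of (A2R) and (A3R)(b) are used: first the parameter is
    fixed, then [n] grows. *)
Lemma limn_esup_cvg0_near {T : Type} {G : set_system T} {FG : Filter G}
    {u : T -> nat -> \bar R} {eta : R} : 0 < eta ->
  limn_esup (u x) @[x --> G] --> 0%E ->
  \forall x \near G, \forall n \near \oo, (u x n < eta%:E)%E.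
Proof.
move=> eta0 /(_ [set y | y < eta%:E]%E) small.
have : nbhs (0%E : \bar R) [set y | (y < eta%:E)%E].
  by exact: open_ereal_lt' (_ : 0 < eta%:E)%E.
move=> /small H; have {}H : G [set x | (limn_esup (u x) < eta%:E)%E] by exact: H.
by apply: filterS H => x /limn_esup_near.
Qed.
End OuterProbability.

(** * Finite covers of a time interval and common radii *)

Section SegmentCover.
Import numFieldNormedType.Exports.

(** Heine-Borel with a property attached to each ball: the finite list keeps [Q] for every selected
    centre and radius. *)
Lemma segment_finite_cover {R : realType} (a b : R) (Q : R -> R -> Prop) :
  (forall t, a <= t <= b -> exists2 h, 0 < h & Q t h) ->
  exists s : seq (R * R), (forall p, p \in s -> 0 < p.2 /\ Q p.1 p.2) /\
    forall t, a <= t <= b -> exists2 p, p \in s & `|t - p.1| < p.2.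
Proof.
move=> local.
have /choice[h hP] t : exists h, a <= t <= b -> 0 < h /\ Q t h.
  have [/local[h h0 Qh]|ntab] := pselect (a <= t <= b); first by exists h.
  by exists 0.
have : @cover_compact R `[a, b] by rewrite -compact_cover; exact: segment_compact.
move=> /(_ _ [set t | a <= t <= b] (fun t => ball t (h t)))[t _|t|D Dab cov].
- exact: ball_open.
- by rewrite /= in_itv => tab; exists t => //; apply: ballxx; have [] := hP t tab.
exists [seq (t, h t) | t <- finmap.enum_fset D]; split.
  move=> _ /mapP[t tD ->]; apply: hP.
  by have := Dab t tD; rewrite inE.
move=> t tab; have [|u uD tu] := cov t; first by rewrite /= in_itv.
exists (u, h u); first by apply/mapP; exists u.
by rewrite distrC.
Qed.
End SegmentCover.

Lemma seq_pos_lb {R : realDomainType} {I : eqType} (s : seq I) (f : I -> R) :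
  (forall i, i \in s -> 0 < f i) ->
  exists2 r, 0 < r & forall i, i \in s -> r <= f i.
Proof.
elim: s => [|j s IH] fs; first by exists 1.
have [i si|r r0 rs] := IH; first by apply: fs; rewrite inE si orbT.
exists (Num.min r (f j)); first by rewrite lt_min r0 fs// mem_head.
by move=> i; rewrite inE => /orP[/eqP->|/rs ri]; rewrite ge_min ?lexx ?orbT// ri.
Qed.

(** * Closedness of F and points between two given points *)

Section ProperMetric.
Context {R : realType} {E : choiceType} {dist : E -> E -> R} {F : set E}.
Hypothesis metric : is_metric dist.
Hypothesis proper : forall x r, 0 < r -> dcompact dist (F `&` dcball dist x r).

Lemma dopen_dball x r : dopen dist (dball dist x r).
Proof.
case: metric => _ _ _ tri y /= xy; exists (r - dist x y); first by rewrite subr_gt0.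
by rewrite /dball => z /= yz; have := tri x y z; lra.
Qed.

(** For [x] outside [F], the sets of points farther than [r] from [x], over all [r > 0], cover the
    compact trace of [F] on the closed unit ball. The least [r] of a finite subcover, capped at 1,
    is the radius of a ball missing [F]. *)
Lemma dopen_complement : dopen dist (~` F).
Proof.
case: metric => ge0 eq0 _ tri x nFx.
have [||s [sC cov]] := proper x _ ltr01 [set U | exists2 r, 0 < r & U = [set y | r < dist x y]].
- move=> _ [r r0 ->] y /= ry; exists (dist x y - r); first by rewrite subr_gt0.
  case: metric => _ _ sym _.
  by rewrite /dball => z /=; have := tri x z y; rewrite (sym z y); lra.
- move=> y [Fy _]; have xy : 0 < dist x y.
    by rewrite lt0r ge0 andbT; apply/eqP => /eq0 yx; apply: nFx; rewrite yx.
  exists [set z | dist x y / 2 < dist x z]; last by rewrite /=; lra.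
  by exists (dist x y / 2) => //; rewrite divr_gt0.
have /choice[f fP] U : exists r, U \in s -> 0 < r /\ U = [set y | r < dist x y].
  have [/sC[r r0 ->]|] := boolP (U \in s); first by exists r.
  by exists 0.
have [U /fP[]//|r r0 rs] := seq_pos_lb s f.
exists (Num.min r 1); first by rewrite lt_min r0 ltr01.
move=> y; rewrite /dball /= lt_min => /andP[yr y1] Fy.
have [|U /= Us Uy] := cov y; first by split => //; exact: ltW.
have [_ UE] := fP U Us; move: Uy; rewrite UE /=.
by have := rs U Us; lra.
Qed.

Hypothesis midpoint : midpoint_property dist F.

(** Repeated midpoints towards [x] halve the distance to [x] and keep the triangle inequality an
    equality. The least number of halvings that brings this distance below [2 * l] leaves it at
    least [l]. *)
Lemma midpoint_between {x y} (l : R) : F x -> F y -> 0 < l -> l <= dist x y ->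
  exists2 z, F z & l <= dist x z < 2 * l /\ dist x z + dist z y = dist x y.
Proof.
case: metric => ge0 eq0 sym tri Fx Fy l0 lxy.
have halving k : exists2 z, F z &
    dist x z = dist x y / 2 ^+ k /\ dist x z + dist z y = dist x y.
  elim: k => [|k [z Fz [xz zy]]].
    by exists y => //; rewrite expr0 divr1 (_ : dist y y = 0) ?addr0//; exact/eq0.
  have [u Fu [xu uz]] := midpoint _ _ Fx Fz; exists u => //; split.
    by rewrite xu xz exprS invfM; lra.
  by have := tri u z y; have := tri x u y; lra.
(* Since [k < 2 ^ k], the halved distances eventually fall below [2 * l]. *)
have ex : exists k : nat, dist x y / 2 ^+ k < 2 * l.
  exists (Num.truncn (dist x y / l)).+1.
  rewrite ltr_pdivrMr ?exprn_gt0//.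
  have := truncnS_gt (dist x y / l); rewrite ltr_pdivrMr//.
  set N := (Num.truncn _).+1 => NN.
  have : N%:R < 2 ^+ N :> R by rewrite -natrX ltr_nat ltn_expl.
  by nra.
case: (ex_minnP ex) => -[|k] kl kmin.
  by have [z Fz [xz zy]] := halving 0%N; exists z => //; split=> //; rewrite xz kl andbT expr0 divr1.
have [z Fz [xz zy]] := halving k.+1; exists z => //; split=> //; rewrite xz kl andbT.
have : ~~ (dist x y / 2 ^+ k < 2 * l).
  by apply/negP => /kmin; rewrite ltnn.
by rewrite -leNgt exprS invfM; lra.
Qed.
End ProperMetric.

(** * Measurability and integrals on F *)

Section BorelMetric.
Context {R : realType} {dE : measure_display} {E : measurableType dE}
  {dist : E -> E -> R} {F : set E} {nu : {measure set E -> \bar R}}.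
Hypothesis metric : is_metric dist.
Hypothesis borel : @measurable _ E = <<s [set U | dopen dist U] >>.
Hypothesis proper : forall x r, 0 < r -> dcompact dist (F `&` dcball dist x r).

Lemma dopen_measurable {U} : dopen dist U -> measurable U.
Proof. by move=> oU; rewrite borel; exact: sub_sigma_algebra. Qed.

Lemma proper_measurable : measurable F.
Proof.
by rewrite -(setCK F); apply/measurableC/dopen_measurable/dopen_complement.
Qed.

Lemma dball_measurable x r : measurable (dball dist x r `&` F).
Proof.
by apply: measurableI; [exact/dopen_measurable/dopen_dball|exact: proper_measurable].
Qed.

Lemma continuous_on_measurable {D : set E} {f : E -> R} : measurable D -> D `<=` F ->
  (forall x, F x -> forall e, 0 < e -> exists2 h, 0 < h &
    forall y, F y -> dist x y < h -> `|f y - f x| < e) ->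
  measurable_fun D f.
Proof.
move=> mD DF cf; apply: (measurability (@RGenOInfty.G R)); first exact: RGenOInfty.measurableE.
move=> _ [_ [c ->] <-].
(* [U] is open in [E] although [f] is controlled only on [F]: around each of its points, the trace
   of some ball on [F] lies above level [c]. *)
pose U := [set z | exists2 r, 0 < r & forall y, F y -> dist z y < r -> c < f y].
rewrite (_ : D `&` _ = D `&` U).
  apply: measurableI => //; apply: dopen_measurable => z [r r0 rz].
  exists (r / 2); first by rewrite divr_gt0.
  rewrite /dball => y /= zy; exists (r / 2); first by rewrite divr_gt0.
  move=> x Fx yx; apply: rz => //.
  by case: metric => _ _ _ /(_ z y x); lra.
apply/seteqP; split => y [Dy] /=.
  rewrite in_itv/= andbT => cy; split=> //.
  have [|h h0 hy] := cf y (DF y Dy) (f y - c); first by rewrite subr_gt0.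
  by exists h => // z Fz /(hy z Fz); rewrite ltr_norml; lra.
move=> [r r0 ry]; split=> //; rewrite in_itv/= andbT; apply: ry; first exact: DF.
by case: metric => _ /(_ y y)[_ ->].
Qed.

Lemma integral_close {D : set E} {f : E -> R} {N u e : R} :
  measurable D -> measurable_fun D f -> nu D = N%:E ->
  (forall y, D y -> 0 <= f y /\ `|f y - u| <= e) ->
  exists2 I : R, (\int[nu]_(y in D) (f y)%:E)%E = I%:E & `|I - u * N| <= e * N.
Proof.
move=> mD mf DN fu.
have mEf : measurable_fun D (EFin \o f) by exact/measurable_EFinP.
have N0 : 0 <= N by rewrite -lee_fin -DN measure_ge0.
have ub : (\int[nu]_(y in D) (f y)%:E <= ((u + e) * N)%:E)%E.
  rewrite EFinM -DN -(integral_cst _ mD); apply: ge0_le_integral => //.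
  - by move=> y /fu[]; rewrite lee_fin.
  - by move=> y /fu[_]; rewrite ler_norml /= lee_fin; lra.
(* Truncation at 0 keeps the lower constant nonnegative, as the comparison of nonnegative integrals
   requires. *)
have lb : (((Num.max (u - e) 0) * N)%:E <= \int[nu]_(y in D) (f y)%:E)%E.
  rewrite EFinM -DN -(integral_cst _ mD); apply: ge0_le_integral => //.
  - by move=> y _; rewrite lee_fin le_max lexx orbT.
  - by move=> y /fu[f0]; rewrite ler_norml /= lee_fin ge_max f0 andbT; lra.
have fin : (\int[nu]_(y in D) (f y)%:E)%E \is a fin_num.
  by rewrite fin_numElt (lt_le_trans _ lb) ?ltNyr// (le_lt_trans ub) ?ltry.
exists (fine (\int[nu]_(y in D) (f y)%:E)); first by rewrite fineK.
move: ub lb; rewrite -(fineK fin) !lee_fin /=; move: (fine _) => I ub lb.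
have : (u - e) * N <= Num.max (u - e) 0 * N by rewrite ler_wpM2r// le_max lexx.
by rewrite ler_norml; lra.
Qed.
End BorelMetric.

(** * From averages over a ball to values at a point *)

(** The choice of [k] gives [k + u * k = e * N], so [J] is within [2 * e * N] of [u * M]. As
    [k <= e * N] and [e <= 2^-1], also [N <= 2 * M]; the total error [e * M + 4 * e * M] is then
    divided by [M]. *)
Lemma ratio_close {R : realFieldType} {Q u N M J e k : R} :
  0 < N -> 0 <= u -> e <= 2^-1 -> k * (1 + u) = e * N ->
  `|J - Q * M| <= e * M -> `|M - N| <= k -> `|J - u * N| <= k + e * N ->
  `|Q - u| <= 5 * e.
Proof.
move=> N0 u0 e2 kE JQ MN JN.
have k0 : 0 <= k by apply: le_trans MN.
have ku0 : 0 <= k * u by rewrite mulr_ge0.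
have eN : e * N <= 2^-1 * N by rewrite ler_pM2r.
have M0 : N <= 2 * M by move: MN; rewrite ler_norml; lra.
have e0 : 0 <= e.
  by rewrite -(pmulr_lge0 _ N0) -kE mulr_ge0//; lra.
have eNM : e * N <= e * (2 * M) by rewrite ler_wpM2l.
have uMN : `|u * (M - N)| <= u * k by rewrite normrM (ger0_norm u0) ler_wpM2l.
have Mp : 0 < M by lra.
rewrite -(ler_pM2r Mp) -[X in _ * X <= _](gtr0_norm Mp) -normrM.
move: JQ JN uMN; rewrite !ler_norml => JQ JN uMN.
by apply/andP; split; lra.
Qed.

(** Instance of [ratio_close] with [M] the rescaled mass of [B] and [J] the mean of two consecutive
    hitting probabilities; both are controlled because [qker] averages over two steps. *)
Lemma qker_close_of_averages {R : realType} {E : choiceType} {V : set E}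
    {adj : E -> E -> Prop} {rho : E} {mu : E -> E -> R} {B : set E}
    {b N u e k : R} {m : nat} {v : E} :
  lf_conn_graph V adj rho -> (forall x y, adj x y -> 0 < mu x y) ->
  finite_set (B `&` V) -> 0 < b -> 0 < N -> 0 <= u -> e <= 2^-1 ->
  k * (1 + u) = e * N ->
  (forall y, (B `&` V) y -> b * `|qker adj mu m rho y - qker adj mu m rho v| <= e) ->
  (`|(b^-1)%:E * gmeas adj mu V B - N%:E| <= k%:E)%E ->
  `|hitp adj mu m B rho - u * N| <= k + e * N ->
  `|hitp adj mu m.+1 B rho - u * N| <= k + e * N ->
  `|b * qker adj mu m rho v - u| <= 5 * e.
Proof.
move=> graph mu_gt0 finB b0 N0 u0 e2 kE osc mass H0 H1.
have Vrho : V rho by case: graph.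
set S := \sum_(y \in B `&` V) wdeg adj mu y.
apply: (@ratio_close _ _ _ N (b^-1 * S)
    ((hitp adj mu m B rho + hitp adj mu m.+1 B rho) / 2) _ k) => //; last 1 first.
- by move: H0 H1; clear; rewrite !ler_norml; lra.
- have := hitp_qker_close graph mu_gt0 m B rho v b e Vrho finB (ltW b0) osc.
  rewrite -/S => close; rewrite -(ler_pM2l b0) -{1}(gtr0_norm b0) -normrM mulrBr.
  have bS x : b * (x * (b^-1 * S)) = x * S by rewrite mulrCA mulVKf// gt_eqF.
  by rewrite !bS.
- by move: mass; rewrite (gmeas_finite graph mu_gt0 _ finB) -/S -EFinM -EFinB abse_EFin lee_fin.
Qed.

(** * Convergence near a point, then on compact sets *)

Section LocalLimit.
Context {R : realType} {dE : measure_display} {E : measurableType dE}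
  {dist : E -> E -> R} {F : set E} {rho : E}
  {nu : {measure set E -> \bar R}} {q : R -> E -> R}
  {V : nat -> set E} {adj : nat -> E -> E -> Prop}
  {dO : measure_display} {Omega : measurableType dO}
  {P : probability Omega R} {w : Omega -> nat -> E -> E -> R}
  {alpha beta gamma : nat -> R} {g : nat -> E -> E} {T1 : R}.
Hypothesis metric : is_metric dist.
Hypothesis borel : @measurable _ E = <<s [set U | dopen dist U] >>.
Hypothesis proper : forall x r, 0 < r -> dcompact dist (F `&` dcball dist x r).
Hypothesis radon : radon_on dist F nu.
Hypothesis support : full_support_on dist F nu.
Hypothesis kernel : limit_kernel dist F nu q.
Hypothesis graph : forall n, lf_conn_graph (V n) (adj n) rho.
Hypothesis weights : random_weights adj w.
Hypothesis alpha_cvg : alpha n @[n --> \oo] --> +oo.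
Hypothesis beta_cvg : beta n @[n --> \oo] --> +oo.
Hypothesis gamma_cvg : gamma n @[n --> \oo] --> +oo.
Hypothesis nearest : forall n x, F x ->
  V n (g n x) /\ forall v, V n v -> dist x (g n x) <= dist x v.
Hypothesis T1_gt0 : 0 < T1.
Hypothesis A1 : A1R dist F rho nu q V adj P w alpha beta gamma.

Let q_cont {t : R} {x} {e : R} : 0 < t -> F x -> 0 < e -> exists2 h : R, 0 < h &
  forall s y, 0 < s -> F y -> `|s - t| < h -> dist x y < h -> `|q s y - q t x| < e.
Proof. by move=> t0 Fx e0; case: kernel => cont _; exact: cont. Qed.

Let locally_finite {x} : F x ->
  exists2 r : R, 0 < r & (nu (dball dist x r `&` F) < +oo)%E.
Proof. by move=> Fx; case: radon => lf _; exact: lf. Qed.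

Let w_gt0 om n x y : adj n x y -> 0 < w om n x y.
Proof. by case: weights => _ [+ _]; apply. Qed.

(** For large [n] the additive error [alt n] is at most [h * alpha n]; the absolute value of [c2] is
    taken because its sign is not given. *)
Lemma gdist_le_dist {r : R} : 0 < r -> exists2 c, 0 <= c &
  forall h, 0 < h -> \forall n \near \oo, 0 < alpha n /\
    forall x y, V n x -> V n y -> dist rho x < r -> dist rho y < r ->
      gdist (adj n) x y <= alpha n * (c * dist x y + h).
Proof.
case: A1 => _ [[alt [_ [alt_o ub]]] _] /ub[c2 [n0 c2P]]; case: metric => ge0 _ _ _.
exists `|c2| => // h /alt_o alt_h; near=> n.
have an : 0 < alpha n by near: n; move/cvgryPgt: alpha_cvg; exact.
split=> // x y Vx Vy rx ry.
have nn : (n0 <= n)%N by near: n; exact: nbhs_infty_ge.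
apply: le_trans (c2P n nn x y Vx Vy rx ry) _.
rewrite mulrDr lerD//; last by rewrite mulrC; near: n.
by rewrite mulrA ler_wpM2r// mulrC ler_wpM2l ?ler_norm// ltW.
Unshelve. all: by end_near. Qed.

(** The event of (A2R) for the time interval from [T1] to [T]. *)
Definition osc_event (r delta e T : R) n : set Omega :=
  [set om | exists x y t,
     [/\ V n x, V n y, gdist (adj n) rho x < alpha n * r,
         gdist (adj n) rho y < alpha n * r &
         gdist (adj n) x y <= alpha n * delta] /\
     T1 <= t <= T /\
     e < beta n * `| qn adj w rho n om (nfloor (gamma n * t)) x
                     - qn adj w rho n om (nfloor (gamma n * t)) y |].

(** [A] restricts the times and points at which a deviation counts; the covering arguments vary
    it. *)
Definition dev_event (e T : R) (A : set (R * E)) n : set Omega :=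
  [set om | exists x t, [/\ F x, T1 <= t <= T, A (t, x) &
     e < `| beta n * qn adj w rho n om (nfloor (gamma n * t)) (g n x) - q t x |]].

(* On the small ball [B] around [x0] both [q^n] (off [osc_event]) and [q] are
   nearly constant, so both point values are close to the averages over [B],
   which (A1R)(c) and (A1R)(d) compare. Step [m + 1] is step [m] at the shifted
   time [t + 1 / gamma n]. *)
Lemma local_limit {r c delta e T t0 : R} {x0 : E} :
  0 <= c -> 0 < delta -> 0 < e -> e <= 2^-1 -> T1 <= t0 <= T ->
  F x0 -> dist rho x0 <= r ->
  (forall h, 0 < h -> \forall n \near \oo, 0 < alpha n /\
    forall x y, V n x -> V n y -> dist rho x < r + 2 -> dist rho y < r + 2 ->
      gdist (adj n) x y <= alpha n * (c * dist x y + h)) ->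
  exists2 h, 0 < h &
    outerP P (dev_event (6 * e) T [set p | `|p.1 - t0| < h /\ dist x0 p.2 < h] n
              `\` osc_event (c * (r + 2) + 2) delta e T n) @[n --> \oo] --> 0%E.
Proof.
move=> c0 delta0 e0 e2 /andP[T1t0 t0T] Fx0 rx0 ub.
case: (metric) => d_ge0 d_eq0 d_sym tri.
case: (kernel) => _ [q_ge0 _]; case: A1 => _ [_ [dense [mass hit]]].
have t0_gt0 : 0 < t0 by exact: lt_le_trans T1t0.
have [h1 h1_gt0 h1P] := q_cont t0_gt0 Fx0 e0.
have [h2 h2_gt0 h2P] := locally_finite Fx0.
have c4 : 0 < 4 * (c + 1) by lra.
(* [h1] serves continuity of [q], [h2] finite mass, [t0] positivity of times, and 1 keeps the ball
   within [r + 2] of [rho]. The last bound makes [c * (2 * h)] at most [delta / 2]. *)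
have [h [h0 hh1 hh2 ht0 hle1]] : exists h : R, [/\ 0 < h, h <= h1, h <= h2, h <= t0 &
    h <= 1 /\ h * (4 * (c + 1)) <= delta].
  exists (Num.min h1 (Num.min h2 (Num.min t0 (Num.min 1 (delta / (4 * (c + 1))))))).
  rewrite !lt_min h1_gt0 h2_gt0 t0_gt0 ltr01 divr_gt0// -ler_pdivlMr//.
  by rewrite !ge_min !lexx !orbT.
case: hle1 => hle1 hdelta.
set u := q t0 x0; have u0 : 0 <= u by exact: q_ge0.
have near_u s y : 0 < s -> `|s - t0| < h -> F y -> dist x0 y < h ->
    0 <= q s y /\ `|q s y - u| <= e.
  move=> s0 st0 Fy xy; split; first exact: q_ge0.
  by apply: ltW; apply: h1P => //; [exact: lt_le_trans hh1|exact: lt_le_trans hh1].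
set B := dball dist x0 h.
have mB r' : measurable (dball dist x0 r' `&` F) by exact: (dball_measurable metric borel proper).
have fB : nu (B `&` F) \is a fin_num.
  rewrite ge0_fin_numE//; apply: le_lt_trans h2P; apply: le_measure; rewrite ?inE; [exact: mB|exact: mB|].
  by apply: setSI => y; rewrite /B /dball /= => xy; exact: lt_le_trans hh2.
set N := fine (nu (B `&` F)); have NE : nu (B `&` F) = N%:E by rewrite fineK.
have N0 : 0 < N by rewrite -lte_fin -NE; exact: support.
have uS : 0 < 1 + u by lra.
(* The tolerance asked of (A1R)(c) and (A1R)(d), in the form expected by [ratio_close]. *)
set k := e * N / (1 + u).
have k0 : 0 < k by rewrite divr_gt0// mulr_gt0.
have kE : k * (1 + u) = e * N by rewrite divfK// gt_eqF.
(* Half the radius, so that [g n x], within [h / 2] of [x], still lies in the ball of radius [h]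
   around [x0]. *)
exists (h / 2); first by rewrite divr_gt0.
(* The time window extends to [t0 + 3 * h / 4] to contain the shifted time as well, since the shift
   will be below [h / 4]. *)
have a0 : 0 < t0 - h / 2 by lra.
have ab : t0 - h / 2 <= t0 + 3 * h / 4 by lra.
apply: (outerP0_sub _ (outerP0_setU (mass x0 h k Fx0 h0 k0) (hit _ _ x0 h k a0 ab Fx0 h0 k0))).
(* The additive error is capped by 1 to stay inside the graph ball of [osc_event], and by the other
   half of [delta]. *)
pose h' := Num.min 1 (delta / 2).
have h'0 : 0 < h' by rewrite lt_min ltr01 divr_gt0.
have h'1 : h' <= 1 by rewrite ge_min lexx.
have h'd : h' <= delta / 2 by rewrite ge_min lexx orbT.
have r0 : 0 < r + 2 by have := d_ge0 rho x0; lra.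
near=> n => om [[x [t [Fx /andP[T1t tT] [/= tt0 x0x] dev]]] nosc].
have hlt s : s < h / 2 -> s < h by lra.
have [an ubn] : 0 < alpha n /\ forall x y, V n x -> V n y ->
    dist rho x < r + 2 -> dist rho y < r + 2 ->
    gdist (adj n) x y <= alpha n * (c * dist x y + h') by near: n; exact: ub.
have bn : 0 < beta n by near: n; move/cvgryPgt: beta_cvg; exact.
have gn : 4 / h < gamma n by near: n; move/cvgryPgt: gamma_cvg; exact.
have densen : forall x, F x -> dist rho x < r + 2 -> exists2 v, V n v & dist x v < h / 2.
  by near: n; apply: dense => //; rewrite divr_gt0.
have gn0 : 0 < gamma n by apply: lt_trans gn; rewrite divr_gt0.
have gVn : (gamma n)^-1 < h / 4 by rewrite -[ltRHS]invrK invf_div ltf_pV2// posrE divr_gt0.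
have [Vv vmin] := nearest n x Fx; set v := g n x in Vv vmin dev.
have Brho y : dist x0 y < h -> dist rho y < r + 2.
  by move=> xy; have := tri rho x0 y; lra.
have xv : dist x v < h / 2.
  have [|v' Vv' xv'] := densen x Fx; first exact/Brho/hlt.
  exact: le_lt_trans (vmin v' Vv') xv'.
have x0v : dist x0 v < h by have := tri x0 x v; lra.
have Grho y : V n y -> dist x0 y < h -> gdist (adj n) rho y < alpha n * (c * (r + 2) + 2).
  move=> Vy /Brho ry; apply: (@le_lt_trans _ _ (alpha n * (c * dist rho y + h'))).
    apply: ubn => //; first by case: (graph n).
    by rewrite (_ : dist rho rho = 0)//; exact/d_eq0.
  rewrite ltr_pM2l//; have : c * dist rho y <= c * (r + 2) by rewrite ler_wpM2l// ltW.
  by lra.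
have Vrho : V n rho by case: (graph n).
have finB : finite_set (B `&` V n).
  apply: sub_finite_set (gdist_ball_finite (graph n) rho (alpha n * (c * (r + 2) + 2)) Vrho).
  by move=> y [x0y Vy]; split=> //; exact: Grho.
(* If neither exceptional event of (A1R) occurs, the rescaled [q^n] at [v] is within [5 * e] of [u],
   and [q t x] within [e], contradicting a deviation above [6 * e]. *)
apply: contrapT => /not_orP[nmass nhit].
have hit_close s : `|s - t0| < h -> t0 - h / 2 <= s <= t0 + 3 * h / 4 ->
    `|hitp (adj n) (w om n) (nfloor (gamma n * s)) B rho - u * N| <= k + e * N.
  move=> st0 sab; have s0 : 0 < s by lra.
  have mq : measurable_fun (B `&` F) (q s).
    apply: (continuous_on_measurable (F := F) metric borel) (mB h) _ _; first by move=> y [].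
    move=> y Fy e' e'0.
    have [h'' h''0 h''P] := q_cont s0 Fy e'0; exists h'' => // z Fz yz.
    by apply: h''P => //; rewrite subrr normr0.
  have [|I IE Iu] := integral_close (u := u) (e := e) (mB h) mq NE.
    by move=> y [x0y Fy]; exact: near_u.
  have hI : `|hitp (adj n) (w om n) (nfloor (gamma n * s)) B rho - I| <= k.
    rewrite leNgt; apply/negP => ksI; apply: nhit; exists s; split=> //.
    by rewrite IE -EFinB abse_EFin lte_fin.
  rewrite (_ : _ - _ = (hitp (adj n) (w om n) (nfloor (gamma n * s)) B rho - I) + (I - u * N)); last by rewrite addrA subrK.
  by apply: le_trans (ler_normD _ _) _; exact: lerD.
set m := nfloor (gamma n * t) in dev.
have mS : nfloor (gamma n * (t + (gamma n)^-1)) = m.+1.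
  rewrite /m /nfloor mulrDr divff ?gt_eqF// addrC truncnD ?truncn1//.
  by rewrite nnegrE mulr_ge0// ltW// (lt_le_trans T1_gt0).
have gV0 : 0 < (gamma n)^-1 by rewrite invr_gt0.
have H0 : `|hitp (adj n) (w om n) m B rho - u * N| <= k + e * N.
  by apply: hit_close; move: tt0 gV0 gVn; rewrite !ltr_norml; lra.
have H1 : `|hitp (adj n) (w om n) m.+1 B rho - u * N| <= k + e * N.
  by rewrite -mS; apply: hit_close; move: tt0; rewrite !ltr_norml; lra.
have osc y : (B `&` V n) y ->
    beta n * `|qker (adj n) (w om n) m rho y - qker (adj n) (w om n) m rho v| <= e.
  move=> [x0y Vy]; rewrite leNgt; apply/negP => osc; apply: nosc.
  exists y, v, t; split; last by rewrite T1t tT.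
  split=> //; [exact: Grho|exact: Grho|].
  apply: le_trans (ubn y v Vy Vv (Brho _ x0y) (Brho _ x0v)) _.
  rewrite ler_pM2l//.
  have yv : dist y v <= 2 * h.
    have := tri y x0 v; rewrite (d_sym y x0); move: x0y; rewrite /B /dball /=.
    by lra.
  have : c * dist y v <= c * (2 * h) by rewrite ler_wpM2l.
  by lra.
have mass_le : (`|(beta n)^-1%:E * gmeas (adj n) (w om n) (V n) B - N%:E| <= k%:E)%E.
  by rewrite leNgt -NE; apply/negP.
have := qker_close_of_averages (graph n) (@w_gt0 om n) finB bn N0 u0 e2 kE osc mass_le H0 H1.
have [_] : 0 <= q t x /\ `|q t x - u| <= e by apply: near_u => //; [exact: lt_le_trans T1t|exact: hlt|exact: hlt].
move: dev; rewrite /qn -/m => dev qu Qu.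
suff : `|beta n * qker (adj n) (w om n) m rho v - q t x| <= 6 * e by rewrite leNgt dev.
by move: qu Qu; rewrite !ler_norml; lra.
Unshelve. all: by end_near. Qed.

(* The compact set [T1, T] x {x in F | dist rho x <= r} is covered by finitely
   many of the neighbourhoods given by [local_limit]. *)
Lemma compact_limit {r c delta e T : R} : 0 < r ->
  0 <= c -> 0 < delta -> 0 < e -> e <= 2^-1 ->
  (forall h, 0 < h -> \forall n \near \oo, 0 < alpha n /\
    forall x y, V n x -> V n y -> dist rho x < r + 2 -> dist rho y < r + 2 ->
      gdist (adj n) x y <= alpha n * (c * dist x y + h)) ->
  outerP P (dev_event (6 * e) T [set p | dist rho p.2 <= r] n
            `\` osc_event (c * (r + 2) + 2) delta e T n) @[n --> \oo] --> 0%E.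
Proof.
move=> r0 c0 delta0 e0 e2 ub; case: (metric) => _ d_eq0 _ _.
pose small A := outerP P (dev_event (6 * e) T A n
  `\` osc_event (c * (r + 2) + 2) delta e T n) @[n --> \oo] --> 0%E.
(* Tube argument: finitely many times cover the interval at [x0], and the least of their radii works
   for all of them. *)
have uniform_time x0 : F x0 -> dist rho x0 <= r ->
    exists2 h, 0 < h & small [set p | dist x0 p.2 < h].
  move=> Fx0 rx0.
  have [t0 t0T|s [sP cov]] := @segment_finite_cover R T1 T
      (fun t h => small [set p | `|p.1 - t| < h /\ dist x0 p.2 < h]).
    exact: local_limit.
  have [p /sP[]//|h h0 hs] := seq_pos_lb s snd.
  exists h => //.
  have := outerP0_bigU s _ (fun p ps => (sP p ps).2).
  apply: outerP0_sub; apply: nearW => n om [[x [t [Fx tT /= xh dev]]] nosc].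
  have [p ps tp] := cov t tT; exists p => //; split=> //.
  by exists x, t; split=> //=; split=> //; apply: lt_le_trans xh (hs p ps).
(* Compactness in space is applied to open sets over which the whole time interval is already
   handled. *)
have [U []//|x [Fx rx]|s [sC cov]] :=
    proper rho r r0 [set U | dopen dist U /\ small [set p | U p.2]].
  have [h h0 sh] := uniform_time x Fx rx; exists (dball dist x h).
    by split; first exact: dopen_dball.
  by rewrite /dball /= (_ : dist x x = 0)//; exact/d_eq0.
have := outerP0_bigU s _ (fun U Us => (sC U Us).2).
apply: outerP0_sub; apply: nearW => n om [[x [t [Fx tT /= rx dev]]] nosc].
have [U Us Ux] := cov x (conj Fx rx); exists U => //; split=> //.
by exists x, t.
Qed.
End LocalLimit.

(** * Assembly of late times, far points and the compact region *)

Theorem theorem6p2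
  (R : realType) (dE : measure_display) (E : measurableType dE)
  (dist : E -> E -> R) (F : set E) (rho : E)
  (nu : {measure set E -> \bar R}) (q : R -> E -> R)
  (V : nat -> set E) (adj : nat -> E -> E -> Prop)
  (dO : measure_display) (Omega : measurableType dO)
  (P : probability Omega R) (w : Omega -> nat -> E -> E -> R)
  (alpha beta gamma : nat -> R) (g : nat -> E -> E) (T1 : R) :
  (* (E, d_E) is a metric space with its Borel sigma-algebra *)
  is_metric dist ->
  @measurable _ E = <<s [set U | dopen dist U] >> ->
  (* F \cap closed balls compact; rho in F *)
  (forall x r, 0 < r -> dcompact dist (F `&` dcball dist x r)) ->
  F rho ->
  (* nu: Radon measure of full support on (F, d_F), extended to E *)
  extended_from F nu -> radon_on dist F nu -> full_support_on dist F nu ->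
  limit_kernel dist F nu q ->
  (* the graphs G^n *)
  (forall n, lf_conn_graph (V n) (adj n) rho) ->
  random_weights adj w ->
  (* scaling sequences *)
  (forall n, 0 <= alpha n) -> (forall n, 0 <= beta n) -> (forall n, 0 <= gamma n) ->
  alpha n @[n --> \oo] --> +oo -> beta n @[n --> \oo] --> +oo ->
  gamma n @[n --> \oo] --> +oo ->
  (* g_n(x): a vertex of G^n minimising d_E(x, .) *)
  (forall n x, F x -> V n (g n x) /\ forall v, V n v -> dist x (g n x) <= dist x v) ->
  0 < T1 ->
  A1R dist F rho nu q V adj P w alpha beta gamma ->
  A2R rho V adj P w alpha beta gamma ->
  A3R dist F rho q V adj P w alpha beta gamma ->
  forall eps : R, 0 < eps ->
    outerP P [set om | exists x t, F x /\ T1 <= t /\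
       eps < `| beta n * qn adj w rho n om (nfloor (gamma n * t)) (g n x)
                - q t x |]
    @[n --> \oo] --> 0%E.
Proof.
move=> metric borel proper Frho ext radon support kernel graph weights.
move=> alpha0 beta0 gamma0 alpha_cvg beta_cvg gamma_cvg nearest T1_gt0 A1 A2 A3 eps eps0.
case: (A1) => -[c1 c1_gt0 lower] [_ [dense _]].
case: A3 => mid [q_late [q_far [qn_late qn_far]]].
case: (metric) => d_ge0 d_eq0 d_sym tri; case: (kernel) => _ [q_ge0 _].
(* [W1] covers late times and [W2] far points; [W3] and [W4] below cover oscillation and the compact
   region. Each gets a quarter of [eta]. *)
pose W1 T n := [set om : Omega | exists x, V n x /\
  eps < beta n * qn adj w rho n om (nfloor (gamma n * T)) x].
pose W2 T r n := [set om : Omega | exists x t, V n x /\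
  ~ (gdist (adj n) rho x < alpha n * r) /\ T1 <= t <= T /\
  eps < beta n * qn adj w rho n om (nfloor (gamma n * t)) x].
apply/outerP0_near => eta eta0; have eta4 : 0 < eta / 4 by rewrite divr_gt0.
(* [local_limit] loses a factor 6 and requires [e <= 2^-1]. *)
pose e := Num.min (eps / 6) 2^-1.
have e0 : 0 < e by rewrite lt_min divr_gt0//= invr_gt0 ltr0n.
have e2 : e <= 2^-1 by rewrite ge_min lexx orbT.
have e6 : 6 * e <= eps by rewrite mulrC -ler_pdivlMr// ge_min lexx.
have [Tq q_Tq] := q_late eps eps0.
(* Order of choices: [T], then [r1] for that [T], then [r] and [c], and last [delta], which depends
   on the graph radius [c * (r + 2) + 2]. *)
have [T [TqT T1T W1_small]] : exists T : R, [/\ Tq <= T, T1 <= T &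
    \forall n \near \oo, (outerP P (W1 T n) < (eta / 4)%:E)%E].
  near (pinfty_nbhs R) => T; exists T; split; near: T;
    [by apply: nbhs_pinfty_ge; rewrite num_real|by apply: nbhs_pinfty_ge; rewrite num_real|].
  exact: (limn_esup_cvg0_near eta4 (qn_late eps eps0)).
have [rq q_rq] := q_far T1 T T1_gt0 T1T eps eps0.
have [r1 [r1_gt0 W2_small]] : exists r1 : R, 0 < r1 /\
    \forall n \near \oo, (outerP P (W2 T r1 n) < (eta / 4)%:E)%E.
  near (pinfty_nbhs R) => r1; exists r1; split; near: r1;
    [by apply: nbhs_pinfty_gt; rewrite num_real|].
  exact: (limn_esup_cvg0_near eta4 (qn_far T1 T eps T1_gt0 T1T eps0)).
(* Beyond [rq] the limit kernel is small. Distance [r1 / c1] from [rho] becomes graph distance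
   [alpha n * r1] by (A1R)(a), and the extra 1 pays for approximating a point of [F] by a vertex. *)
pose r := Num.max rq (r1 / c1 + 1).
have rq_le : rq <= r by rewrite le_max lexx.
have r1_le : r1 / c1 + 1 <= r by rewrite le_max lexx orbT.
have r_gt0 : 0 < r by apply: lt_le_trans r1_le; rewrite addr_gt0// divr_gt0.
have r2_gt0 : 0 < r + 2 by rewrite addr_gt0.
have [c c0 upper] := gdist_le_dist metric alpha_cvg A1 r2_gt0.
have rG_gt0 : 0 < c * (r + 2) + 2 by rewrite ltr_wpDl// mulr_ge0// ltW.
pose W3 delta n := @osc_event _ _ _ rho V adj _ _ w alpha beta gamma T1
  (c * (r + 2) + 2) delta e T n.
have [delta [delta0 W3_small]] : exists delta : R, 0 < delta /\ \forall n \near \oo,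
    (outerP P (W3 delta n) < (eta / 4)%:E)%E.
  near (0 : R)^'+ => delta; exists delta; split; near: delta;
    [exact: nbhs_right_gt|].
  exact: (limn_esup_cvg0_near eta4 (A2 T1 T _ e T1_gt0 T1T rG_gt0 e0)).
pose W4 n := @dev_event _ _ _ F rho q adj _ _ w beta gamma g T1 (6 * e) T [set p | dist rho p.2 <= r] n
  `\` W3 delta n.
have /outerP0_near/(_ _ eta4) W4_small := compact_limit metric borel proper radon
  support kernel graph weights beta_cvg gamma_cvg nearest T1_gt0 A1
  (T := T) r_gt0 c0 delta0 e0 e2 upper.
near=> n.
have bn : 0 < beta n by near: n; move/cvgryPgt: beta_cvg; exact.
have an : 0 < alpha n by near: n; move/cvgryPgt: alpha_cvg; exact.
have dense_n : forall x, F x -> dist rho x < 2 * r -> exists2 v, V n v & dist x v < 1.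
  by near: n; apply: dense => //; rewrite mulr_gt0.
have gn0 : 0 <= gamma n by exact: gamma0.
apply: (@le_lt_trans _ _ (outerP P ((W1 T n `|` W2 T r1 n) `|` (W3 delta n `|` W4 n)))); last first.
  have -> : eta = (eta / 4 + eta / 4) + (eta / 4 + eta / 4) by clear; lra.
  by apply: outerPU_le; apply: outerPU_le; near: n.
apply: le_outerP => om [x [t [Fx [T1t dev]]]].
have [Vv vmin] := nearest n x Fx; set v := g n x in Vv vmin dev.
have t0 : 0 < t by exact: lt_le_trans T1t.
have mu_gt0 y z : adj n y z -> 0 < w om n y z by case: weights => _ [+ _]; apply.
have mu_sym y z : w om n y z = w om n z y by case: weights.
(* Two nonnegative numbers at most [eps] differ by at most [eps], so outside the compact region it
   suffices to bound each kernel separately. *)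
have not_both : q t x <= eps ->
    beta n * qn adj w rho n om (nfloor (gamma n * t)) v <= eps -> False.
  move=> q_le qn_le; move: dev; apply/negP; rewrite -leNgt.
  have := q_ge0 t x t0 Fx.
  have : 0 <= beta n * qn adj w rho n om (nfloor (gamma n * t)) v.
    by rewrite mulr_ge0//; exact: (qker_ge0 (graph n) mu_gt0).
  by move: q_le qn_le; clear; rewrite ler_norml; lra.
have [Tt|tT] := leP T t.
  left; left; apply: contrapT => nW1.
  apply: not_both; first by apply: q_Tq => //; exact: le_trans Tt.
  rewrite mulrC -ler_pdivlMr//.
  apply: (qker_ub_nincr (graph n) mu_sym mu_gt0 rho _ (nfloor (gamma n * T)) _ _ _ _ Vv).
    by apply: (@le_truncn R); rewrite ler_wpM2l.
  move=> y Vy; rewrite ler_pdivlMr// mulrC leNgt; apply/negP => qy.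
  by apply: nW1; exists y.
have tI : T1 <= t <= T by rewrite T1t ltW.
have [rx|xr] := leP (dist rho x) r.
  right; have [osc|nosc] := pselect (W3 delta n om).
    by left.
  by right; split=> //; exists x, t; split=> //; exact: le_lt_trans dev.
left; right; apply: contrapT => nW2.
apply: not_both.
  by apply: (q_rq r) => //; apply/negP; rewrite -leNgt ltW.
rewrite leNgt; apply/negP => qv; apply: nW2; exists v, t; split=> //; split=> //.
apply/negP; rewrite -leNgt; apply: le_trans (lower n rho v _ Vv); last by case: (graph n).
rewrite mulrAC mulrC ler_pM2r//.
(* [V n] comes within 1 of a point [z] between [rho] and [x] at distance at
   least [r] from [rho]; hence [v] is closer to [x] than [rho] is by about [r]. *)
have [z Fz [/andP[rz z2r] zx]] := midpoint_between metric mid r Frho Fx r_gt0 (ltW xr).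
have [v' Vv' zv'] := dense_n z Fz z2r.
rewrite mulrC -ler_pdivrMr//.
have := vmin v' Vv'; have := tri x z v'; have := tri rho v x.
rewrite (d_sym x z) (d_sym v x); move: rz zx zv' r1_le; clear; lra.
Unshelve. all: by end_near. Qed.
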